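(* Assume that $D$ is a bounded strictly convex domain in a Banach space. If $S=\{f_t:D\to D\}_{t\ge0}$ is a one-parameter continuous semigroup of nonexpansive mappings with respect to the Hilbert metric $d_H$, and there exists $t_0>0$ such that $\mathrm{Fix}(f_{t_0})=\emptyset$ and the mapping $f_{t_0}$ is compact, then there exists $\xi\in\partial D$ such that the semigroup $S$ converges uniformly on bounded sets of $D$ to $\xi$, i.e. $\sup_{x\in C}\|f_t(x)-\xi\|\to0$ as $t\to\infty$ for every $d_H$-bounded set $C\subset D$.
   Context: $\overline{D}$ is the closure of $D$ in the norm topology and $\partial D=\overline{D}\setminus D$. $D$ is strictly convex if for any distinct $z,w\in\overline{D}$ the open segment $\{sz+(1-s)w:s\in(0,1)\}$ lies in $D$. Hilbert metric on a bounded convex domain $D$: $d_H(x,x)=0$, and for $x\ne y$ in $D$, the straight line through $x$ and $y$ meets $\partial D$ in exactly two points $a,b$, labelled so that $x$ is between $a$ and $y$ and $y$ is between $x$ and $b$, and $$d_H(x,y)=\log\left(\frac{\|y-a\|\,\|x-b\|}{\|x-a\|\,\|y-b\|}\right).$$ A map $f:D\to D$ is nonexpansive with respect to $d_H$ if $d_H(f(x),f(y))\le d_H(x,y)$ for all $x,y\in D$; it is compact if the norm closure of $f(D)$ is compact in $\overline{D}$. $\mathrm{Fix}(f)=\{x\in D:f(x)=x\}$. A family $S=\{f_t:D\to D\}_{t\ge0}$ is a one-parameter continuous semigroup if $f_{s+t}=f_t\circ f_s$ for all $s,t\ge0$ and $\lim_{t\to0^+}f_t(y)=f_0(y)=y$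 for every $y\in D$ (the topology of $d_H$ on $D$ coincides with the norm topology). *)

(* Defs.v *)
From HB Require Import structures.
From mathcomp Require Import all_boot all_order all_algebra.
From mathcomp Require Import all_classical all_reals all_analysis.
Set Implicit Arguments.
Unset Strict Implicit.
Unset Printing Implicit Defensive.
Import Order.TTheory GRing.Theory Num.Theory.
Import numFieldNormedType.Exports.
Local Open Scope classical_set_scope.
Local Open Scope ring_scope.

Section HilbertMetric.
Context {R : realType} {V : normedModType R}.
Implicit Types (D C : set V) (x y a b : V) (f : V -> V).

Definition domain D := [/\ D !=set0, open D & connected D].

Definition bdry D : set V := closure D `\` D.

Definition open_segment x y : set V :=
  [set s *: x + (1 - s) *: y | s in [set s : R | 0 < s < 1]].

Definition strictly_convex D := forall z w,
  closure D z -> closure D w -> z != w -> open_segment z w `<=` D.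

(* [p = (a, b)]: the points where the line through [x] and [y] meets the
   boundary, in the order a, x, y, b. *)
Definition chord_ends D x y : set (V * V) :=
  [set p | [/\ bdry D p.1, bdry D p.2,
               open_segment p.1 y x & open_segment x p.2 y]].

(* The default value [(0, 0)] is never used when [D] is a bounded convex domain
   and [x], [y] are distinct points of [D]. *)
Definition hilbert_dist D x y : R :=
  if x == y then 0 else
  let p := xget (0, 0) (chord_ends D x y) in
  ln ((`|y - p.1| * `|x - p.2|) / (`|x - p.1| * `|y - p.2|)).

Definition hilbert_nonexpansive D f := forall x y, D x -> D y ->
  hilbert_dist D (f x) (f y) <= hilbert_dist D x y.

Definition hilbert_bounded D C :=
  exists M : R, forall x y, C x -> C y -> hilbert_dist D x y <= M.

Definition compact_map D f := compact (closure (f @` D)).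

Definition fixed_points D f : set V := [set x | D x /\ f x = x].

(* A family of self-maps of [D] indexed by [t >= 0] is represented by a total
   function; its values for [t < 0] or off [D] are irrelevant. *)
Definition continuous_semigroup D (F : R -> V -> V) :=
  [/\ forall t, 0 <= t -> F t @` D `<=` D,
      forall s t y, 0 <= s -> 0 <= t -> D y -> F (s + t) y = F t (F s y),
      forall y, D y -> F 0 y = y &
      forall y, D y -> F t y @[t --> 0^'+] --> y].

End HilbertMetric.

(* Main.v *)
(* By strict convexity, exp d(x, y) is the least product m n such that
   (x, 1) <= m (y, 1) and (y, 1) <= n (x, 1) in the closed cone over D.  This gives
   the triangle inequality, the convexity of balls, the additivity of d at midpoints
   and the strict contractivity of homotheties centred in D.

   Let f = f_t0.  If an orbit of f is bounded, its asymptotic balls are convex and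
   invariant, and the fixed points of s z + (1 - s) f, which minimise the displacement,
   converge to a fixed point of f as s -> 0.  So all orbits are unbounded, and by
   Calka's argument they leave every bounded set.  Along the record times k of
   d(f^k o, o), compactness gives a limit xi in the boundary.  The Gromov products of
   f^k o with f^n x are unbounded, whereas those of sequences with distinct limits in
   the boundary are bounded, so every limit of f^n x is xi.  The passage to continuous
   time writes t = n t0 + s with 0 <= s <= t0. *)
Require Import Defs.
From HB Require Import structures.
From mathcomp Require Import all_boot all_order all_algebra.
From mathcomp Require Import all_classical all_reals all_analysis.
From mathcomp Require Import ring lra zify.
Import Order.TTheory GRing.Theory Num.Theory.
Import numFieldNormedType.Exports.
Local Open Scope classical_set_scope.
Local Open Scope ring_scope.

(** * Reflection of identities between linear combinations in a module *)

Section ModuleReflection.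
Context {R : pzRingType} {V : lmodType R}.

Inductive mexpr :=
  | MVar of nat
  | MZero
  | MAdd of mexpr & mexpr
  | MOpp of mexpr
  | MScale of R & mexpr.

Fixpoint meval (env : seq V) (e : mexpr) : V :=
  match e with
  | MVar i => nth 0 env i
  | MZero => 0
  | MAdd a b => meval env a + meval env b
  | MOpp a => - meval env a
  | MScale c a => c *: meval env a
  end.

Fixpoint mcoef (e : mexpr) (i : nat) : R :=
  match e with
  | MVar j => if eqn i j then 1 else 0
  | MZero => 0
  | MAdd a b => mcoef a i + mcoef b i
  | MOpp a => - mcoef a i
  | MScale c a => c * mcoef a i
  end.

(** An explicit conjunction instead of a quantification over indices, so that it computes to one
    scalar equation per vector, in reach of [ring] and [field]. *)
Fixpoint same_coefs (n : nat) (e1 e2 : mexpr) : Prop :=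
  if n is m.+1 then mcoef e1 m = mcoef e2 m /\ same_coefs m e1 e2 else True.

Lemma meval_coef env e :
  meval env e = \sum_(i < size env) mcoef e i *: nth 0 env i.
Proof.
elim: e => /= [j||a -> b ->|a ->|c a ->].
- have [jn|nj] := ltnP j (size env).
    rewrite (bigD1 (Ordinal jn)) //= big1 ?addr0 => [|i].
      by case: eqnP => // _; rewrite scale1r.
    by rewrite -val_eqE /=; case: eqnP => [->|_ _]; rewrite ?eqxx // scale0r.
  rewrite nth_default // big1 // => i _; case: eqnP => [ij|_].
    by have := ltn_ord i; rewrite ij ltnNge nj.
  by rewrite scale0r.
- by rewrite big1 // => i _; rewrite scale0r.
- by rewrite -big_split /=; apply: eq_bigr => i _; rewrite scalerDl.
- by rewrite -sumrN; apply: eq_bigr => i _; rewrite scaleNr.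
- by rewrite scaler_sumr; apply: eq_bigr => i _; rewrite scalerA.
Qed.

Lemma meval_eq env e1 e2 :
  same_coefs (size env) e1 e2 -> meval env e1 = meval env e2.
Proof.
rewrite !meval_coef; elim: (size env) => [|n IHn] /=; first by rewrite !big_ord0.
by move=> [e12 /IHn]; rewrite !big_ord_recr /= => ->; rewrite e12.
Qed.

End ModuleReflection.

Ltac module_index x env :=
  lazymatch env with
  | cons x _ => constr:(O)
  | cons _ ?env' => let n := module_index x env' in constr:(S n)
  end.

Ltac module_vars t env :=
  lazymatch t with
  | (?a + ?b)%R => let env' := module_vars a env in module_vars b env'
  | (- ?a)%R => module_vars a env
  | (_ *: ?a)%R => module_vars a env
  | 0%R => env
  | _ => lazymatch env with
         | context [cons t _] => env
         | _ => constr:(cons t env)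
         end
  end.

Ltac module_reify R t env :=
  lazymatch t with
  | (?a + ?b)%R =>
      let a' := module_reify R a env in
      let b' := module_reify R b env in constr:(MAdd a' b')
  | (- ?a)%R => let a' := module_reify R a env in constr:(MOpp a')
  | (?c *: ?a)%R => let a' := module_reify R a env in constr:(MScale c a')
  | 0%R => constr:(@MZero R)
  | _ => let n := module_index t env in constr:(@MVar R n)
  end.

(* Reduces an equality between linear combinations in an [R]-module to the
   equalities between the coefficients of each vector. *)
Ltac module_eq R :=
  lazymatch goal with
  | |- @eq ?V ?a ?b =>
      let env0 := constr:(@nil V) in
      let env1 := module_vars a env0 in
      let env := module_vars b env1 in
      let a' := module_reify R a env in
      let b' := module_reify R b env in
      apply: (@meval_eq R _ env a' b');
      lazy beta iota zeta delta [same_coefs mcoef eqn size];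
      do ?[split => //]
  end.

(** * Closure, openness, boundedness and compactness in terms of the norm *)

Section NormedSpace.
Set Implicit Arguments.
Unset Strict Implicit.
Context {R : realType} {V : normedModType R}.
Implicit Types (A : set V) (p q : V).

Lemma closure_normP A p :
  closure A p <-> forall e, 0 < e -> exists2 q, A q & `|p - q| < e.
Proof.
split=> [Ap e e0|Ap B /nbhs_ballP[e /= e0 eB]].
  by have [q [Aq]] := Ap _ (nbhsx_ballx p e e0); rewrite -ball_normE => ?; exists q.
have [q Aq pq] := Ap e e0; exists q; split => //.
by apply: eB; rewrite -ball_normE.
Qed.

Lemma open_normP A p :
  open A -> A p -> exists2 e, 0 < e & forall q, `|p - q| < e -> A q.
Proof.
move=> oA Ap; have /nbhs_ballP[e /= e0 eA] := open_nbhs_nbhs (conj oA Ap).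
by exists e => // q pq; apply: eA; rewrite -ball_normE.
Qed.

Lemma bounded_normP A :
  bounded_set A -> exists2 B : R, 0 < B & forall p, A p -> `|p| <= B.
Proof.
move=> [M [_ MA]]; exists (`|M| + 1); first by rewrite ltr_wpDl.
by move=> p Ap; apply: MA => //; rewrite ltr_pwDr // ler_norm.
Qed.

Lemma compact_cluster_seq A (u : nat -> V) : compact A -> (forall n, A (u n)) ->
  exists2 p, A p & forall e, 0 < e -> forall N, exists2 n, (N <= n)%N & `|u n - p| < e.
Proof.
move=> cA Au; have uA : (u @ \oo) A by exists 0%N => // n _; exact: Au.
have [p [Ap up]] := cA _ (fmap_proper_filter u eventually_filter) uA.
exists p => // e e0 N.
have [|q [[n /= Nn <-]]] := up [set u n | n in [set n | (N <= n)%N]] (ball p e) _ (nbhsx_ballx p e e0).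
  by exists N => // n /= Nn; exists n.
by rewrite -ball_normE /= distrC; exists n.
Qed.

End NormedSpace.

(** * Real sequences and record times *)

Section RealSequences.
Set Implicit Arguments.
Unset Strict Implicit.
Context {R : realType}.

Lemma invS_small (e : R) : 0 < e -> exists N, forall n, (N <= n)%N -> n.+1%:R^-1 < e.
Proof.
move=> e0; have [N _ NP] := near_infty_natSinv_lt (PosNum e0).
by exists N => n Nn; exact: NP.
Qed.

(** The first time at which [g] exceeds its maximum [A] over the indices up to [N] is a record, and
    it comes after [N]. *)
Lemma record_time (g : nat -> R) :
  (forall M, exists N, forall n, (N <= n)%N -> M < g n) ->
  forall N, exists2 n, (N <= n)%N & forall m, (m <= n)%N -> g m <= g n.
Proof.
move=> goo N.
have [A AP] : exists A, forall m, (m <= N)%N -> g m <= A.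
  elim: N => [|N [A AP]]; first by exists (g 0%N) => m; rewrite leqn0 => /eqP->.
  exists (Num.max A (g N.+1)) => m; rewrite leq_eqVlt le_max => /predU1P[->|mN].
    by rewrite lexx orbT.
  by rewrite AP.
have exA : exists n, A < g n by have [n nP] := goo A; exists n; exact: nP.
have [n An nmin] := ex_minnP exA.
exists n => [|m]; first by rewrite leqNgt; apply/negP => /ltnW/AP; rewrite leNgt An.
rewrite leq_eqVlt => /predU1P[->//|mn]; apply: le_trans (ltW An).
by rewrite leNgt; apply/negP => /nmin; rewrite leqNgt mn.
Qed.

End RealSequences.

(** * The Hilbert metric of a strictly convex domain *)

(* [cone_le D x y m] is the inequality [(x, 1) <= m (y, 1)] for the order of
   [V * R] given by the closed cone generated by [closure D * {1}]. *)
Definition cone_le {R : realType} {V : normedModType R} (D : set V) x y (m : R) :=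
  1 <= m /\ exists2 b, closure D b & x = m *: y - (m - 1) *: b.

Section StrictlyConvexDomain.
Set Implicit Arguments.
Unset Strict Implicit.
Context {R : realType} {V : normedModType R} (D : set V).
Context (oD : open D) (bD : bounded_set D) (sD : strictly_convex D).
Implicit Types (x y z a b o : V) (m n s e M : R).
Local Notation cle := (cone_le D).
Local Notation d := (hilbert_dist D).

Lemma interior_segment a b s :
  D a -> closure D b -> 0 < s <= 1 -> D (s *: a + (1 - s) *: b).
Proof.
move=> Da Db /andP[s0]; rewrite le_eqVlt => /predU1P[->|s1].
  by rewrite subrr scale1r scale0r addr0.
have [->|ab] := eqVneq b a; first by rewrite -scalerDl addrC subrK scale1r.
apply: (sD (subset_closure Da) Db); first by rewrite eq_sym.
by exists s => //=; rewrite s0.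
Qed.

(** Closedness under addition of the cone over [closure D]: the sum of [(m a, m)] and [(n b, n)] is
    [(m + n)(c, 1)]. *)
Lemma closure_mix a b m n : closure D a -> closure D b -> 0 <= m -> 0 <= n ->
  exists2 c, closure D c & m *: a + n *: b = (m + n) *: c.
Proof.
move=> Da Db; rewrite le_eqVlt => /predU1P[<- _|m0].
  by exists b => //; rewrite scale0r !add0r.
rewrite le_eqVlt => /predU1P[<-|n0].
  by exists a => //; rewrite scale0r !addr0.
have [->|ab] := eqVneq a b; first by exists b => //; rewrite scalerDl.
have mn0 : 0 < m + n by rewrite addr_gt0.
exists ((m / (m + n)) *: a + (1 - m / (m + n)) *: b); last first.
  by module_eq R; field; rewrite gt_eqF.
apply: subset_closure; apply: (sD Da Db ab).
exists (m / (m + n)) => //=; rewrite divr_gt0 //= ltr_pdivrMr // mul1r.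
by rewrite ltrDl.
Qed.

(** * The order of the cone over [D] *)

Lemma cone_le_refl x : D x -> cle x x 1.
Proof.
move=> Dx; split => //; exists x; first exact: subset_closure.
by module_eq R; ring.
Qed.

Lemma cone_le_trans x y z m n : cle x y m -> cle y z n -> cle x z (m * n).
Proof.
move=> [m1 [b Db ->]] [n1 [c Dc ->]].
have [||w Dw mix] := @closure_mix b c (m - 1) (m * (n - 1)) Db Dc.
- by rewrite subr_ge0.
- by rewrite mulr_ge0 ?subr_ge0 // (le_trans _ m1).
split; first by rewrite (le_trans m1) // ler_peMr // (le_trans _ m1).
exists w => //; have -> : m * n - 1 = m - 1 + m * (n - 1) by ring.
by rewrite -mix; module_eq R; ring.
Qed.

Lemma cone_le_convexl y1 y2 w m n s : 0 <= s <= 1 -> cle y1 w m -> cle y2 w n ->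
  cle (s *: y1 + (1 - s) *: y2) w (s * m + (1 - s) * n).
Proof.
move=> /andP[s0 s1] [m1 [b Db ->]] [n1 [c Dc ->]].
have [||v Dv mix] := @closure_mix b c (s * (m - 1)) ((1 - s) * (n - 1)) Db Dc.
- by rewrite mulr_ge0 // subr_ge0.
- by rewrite mulr_ge0 // subr_ge0.
split; first by nra.
exists v => //.
have -> : s * m + (1 - s) * n - 1 = s * (m - 1) + (1 - s) * (n - 1) by ring.
by rewrite -mix; module_eq R; ring.
Qed.

(** Solved for the right argument, the relation reads [y1 = w / m + (1 - 1 / m) b], which is affine
    in [1 / m]; hence a harmonic mean of the factors. *)
Lemma cone_le_convexr y1 y2 w m n s : 0 <= s <= 1 -> cle w y1 m -> cle w y2 n ->
  cle w (s *: y1 + (1 - s) *: y2) (s / m + (1 - s) / n)^-1.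
Proof.
move=> /andP[s0 s1] [m1 [b Db wb]] [n1 [c Dc wc]].
have m0 : 0 < m by rewrite (lt_le_trans _ m1).
have n0 : 0 < n by rewrite (lt_le_trans _ n1).
have im1 : m^-1 <= 1 by rewrite invf_le1.
have in1 : n^-1 <= 1 by rewrite invf_le1.
have im0 : 0 < m^-1 by rewrite invr_gt0.
have in0 : 0 < n^-1 by rewrite invr_gt0.
have y1E : y1 = m^-1 *: w + (1 - m^-1) *: b.
  by rewrite wb; module_eq R; field; rewrite gt_eqF.
have y2E : y2 = n^-1 *: w + (1 - n^-1) *: c.
  by rewrite wc; module_eq R; field; rewrite gt_eqF.
rewrite y1E y2E {y1 y2 y1E y2E wb wc}.
(* From here on [m] and [n] denote the inverses of the original factors. *)
move: (m^-1) (n^-1) im1 in1 im0 in0 => {m0 n0 m1 n1} {}m {}n m1 n1 m0 n0.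
have [||v Dv mix] := @closure_mix b c (s * (1 - m)) ((1 - s) * (1 - n)) Db Dc.
- by rewrite mulr_ge0 // subr_ge0.
- by rewrite mulr_ge0 // subr_ge0.
have A0 : 0 < s * m + (1 - s) * n by nra.
split; first by rewrite invf_ge1 //; nra.
exists v => //.
have -> : s *: (m *: w + (1 - m) *: b) + (1 - s) *: (n *: w + (1 - n) *: c) =
   (s * m + (1 - s) * n) *: w + (1 - (s * m + (1 - s) * n)) *: v.
  have -> : 1 - (s * m + (1 - s) * n) = s * (1 - m) + (1 - s) * (1 - n) by ring.
  by rewrite -mix; module_eq R; ring.
by module_eq R; field; rewrite gt_eqF.
Qed.

(** An interior end [b] can be pushed further along the line from [x], to [b + t (b - x)], and a
    more distant end means a smaller factor. *)
Lemma cone_le_strict x y b m : 1 < m -> D b -> x = m *: y - (m - 1) *: b ->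
  exists2 n, n < m & cle x y n.
Proof.
move=> m1 Db xE; have [r r0 rD] := open_normP oD Db.
pose t := r / 2 / (1 + `|b - x|).
have k0 : 0 < 1 + `|b - x| by rewrite ltr_wpDr.
have t0 : 0 < t by rewrite !divr_gt0.
have mt0 : 0 < 1 + m * t by nra.
exists ((1 + t) * m / (1 + m * t)).
  rewrite ltr_pdivrMr // -subr_gt0.
  have -> : m * (1 + m * t) - (1 + t) * m = m * t * (m - 1) by ring.
  by rewrite !mulr_gt0 //; lra.
split; first by rewrite ler_pdivlMr //; nra.
exists (b + t *: (b - x)).
  apply: subset_closure; apply: rD; rewrite opprD addNKr normrN normrZ gtr0_norm //.
  rewrite /t mulrAC ltr_pdivrMr //; have := normr_ge0 (b - x); nra.
have -> : b = (m - 1)^-1 *: (m *: y - x).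
  by rewrite xE; module_eq R; field; rewrite gt_eqF // subr_gt0.
by module_eq R; field; rewrite ?gt_eqF // ?subr_gt0.
Qed.

(** The ray from [x] through [y] is followed beyond [y] up to the supremum of the parameters that
    stay in [D]. Boundedness makes it finite; openness makes it positive and not attained. *)
Lemma chord_end x y : D x -> D y -> x != y ->
  exists2 b, bdry D b & exists2 s, 0 < s < 1 & y = s *: x + (1 - s) *: b.
Proof.
move=> Dx Dy xy; have [B B0 DB] := bounded_normP bD.
have yx0 : 0 < `|y - x| by rewrite normr_gt0 subr_eq0 eq_sym.
pose S := [set s | 0 <= s /\ D (y + s *: (y - x))].
have S0 : S 0 by split => //; rewrite scale0r addr0.
have supS : has_sup S.
  split; first by exists 0.
  exists ((B + `|y|) / `|y - x|) => s [s0 /DB Ds].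
  rewrite ler_pdivlMr // -(ger0_norm s0) -normrZ.
  have -> : s *: (y - x) = (y + s *: (y - x)) - y by module_eq R; ring.
  by rewrite (le_trans (ler_normB _ _)) // lerD2r.
have S_le s : S s -> s <= sup S by exact: (ub_le_sup supS.2).
have sup0 : 0 <= sup S by exact: S_le.
have Ncl : ~ D (y + sup S *: (y - x)).
  move=> Dsup; have [r r0 rD] := open_normP oD Dsup.
  have : S (sup S + r / 2 / `|y - x|).
    split; first by rewrite addr_ge0 // !divr_ge0 // ltW.
    apply: rD; set t := r / 2 / _.
    have -> : y + sup S *: (y - x) - (y + (sup S + t) *: (y - x)) = - (t *: (y - x)).
      by module_eq R; ring.
    rewrite normrN normrZ gtr0_norm ?divr_gt0 // mulfVK ?gt_eqF //; lra.
  by move=> /S_le; rewrite gerDl leNgt !divr_gt0.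
exists (y + sup S *: (y - x)).
  split => //; apply/closure_normP => e e0.
  have [|s Ss sup_s] := sup_adherent (eps := e / `|y - x|) _ supS.
    by rewrite divr_gt0.
  exists (y + s *: (y - x)); first by case: Ss.
  have -> : y + sup S *: (y - x) - (y + s *: (y - x)) = (sup S - s) *: (y - x).
    by module_eq R; ring.
  rewrite normrZ ger0_norm ?subr_ge0 ?S_le // -ltr_pdivlMr //; lra.
have sup_gt0 : 0 < sup S.
  rewrite lt_neqAle sup0 andbT; apply/eqP => sup_0; apply: Ncl.
  by rewrite -sup_0 scale0r addr0.
have s1 : 0 < 1 + sup S by lra.
exists (sup S / (1 + sup S)).
  by rewrite divr_gt0 //= ltr_pdivrMr //; lra.
by module_eq R; field; rewrite gt_eqF.
Qed.

(* Strict convexity: were [b'] the end of a chord strictly beyond the boundary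
   point [b], then [b] would be interior to the segment from [y] to [b']. *)
Lemma cone_le_minimal x y b m n : D y -> x != y -> bdry D b -> 1 < m ->
  x = m *: y - (m - 1) *: b -> cle x y n -> m <= n.
Proof.
move=> Dy xy [_ NDb] m1 xE [n1 [c Dc xE']]; rewrite leNgt; apply/negP => nm.
have {}n1 : 1 < n.
  rewrite lt_neqAle n1 andbT; apply: contra xy => /eqP n1'.
  by rewrite xE' -n1' subrr scale0r subr0 scale1r.
have n0 : 0 < n - 1 by lra.
have m0 : 0 < m - 1 by lra.
apply: NDb; have := @interior_segment y c ((m - n) / (m - 1)) Dy Dc.
have -> : (m - n) / (m - 1) *: y + (1 - (m - n) / (m - 1)) *: c = b.
  have -> : c = (n - 1)^-1 *: (n *: y - x).
    by rewrite xE'; module_eq R; field; rewrite gt_eqF.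
  by rewrite xE; module_eq R; field; rewrite ?gt_eqF.
by apply; rewrite divr_gt0 ?subr_gt0 //= ler_pdivrMr //; lra.
Qed.

Lemma hilbert_distE x y : D x -> D y -> x != y ->
  exists m n a b, [/\ [/\ 1 < m, bdry D b & x = m *: y - (m - 1) *: b],
    [/\ 1 < n, bdry D a & y = n *: x - (n - 1) *: a] & d x y = ln (m * n)].
Proof.
move=> Dx Dy xy; rewrite /hilbert_dist (negPf xy).
(* Nonemptiness rules out the default value of [xget]; the identities below hold for whichever pair
   it picks. *)
have : chord_ends D x y !=set0.
  have [b Bb [s s01 yE]] := chord_end Dx Dy xy.
  have [|a Ba [t t01 xE]] := chord_end Dy Dx; first by rewrite eq_sym.
  exists (a, b); split => //=.
    exists (1 - t) => /=; first by lra.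
    by rewrite [RHS]xE; module_eq R; ring.
  by exists s.
move=> /(xgetPex (0, 0)); case: (xget _ _) => a b /= [Ba Bb].
move=> [s /= /andP[s0 s1] xE] [t /= /andP[t0 t1] yE].
exists (t^-1), ((1 - s)^-1), a, b.
have s1' : 0 < 1 - s by lra.
split.
- split => //; first by rewrite invf_gt1.
  by rewrite -yE; module_eq R; field; rewrite gt_eqF.
- split => //; first by rewrite invf_gt1 //; lra.
  by rewrite -xE; module_eq R; field; rewrite gt_eqF.
have -> : `|x - b| = t^-1 * `|y - b|.
  rewrite -[t^-1]gtr0_norm ?invr_gt0 // -normrZ; congr (`| _ |).
  by rewrite -yE; module_eq R; field; rewrite gt_eqF.
have -> : `|y - a| = (1 - s)^-1 * `|x - a|.
  rewrite -[(1 - s)^-1]gtr0_norm ?invr_gt0 // -normrZ; congr (`| _ |).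
  by rewrite -xE; module_eq R; field; rewrite gt_eqF.
congr ln; field; rewrite (gt_eqF t0) (gt_eqF s1') !normr_eq0 !subr_eq0 /=.
by apply/andP; split; apply/eqP => E; [case: Bb|case: Ba]; rewrite -E.
Qed.

(** The factors read off the chord are minimal by [cone_le_minimal]. With [hilbert_dist_cone], where
    they are attained, this replaces cross ratios by cone inequalities. *)
Lemma hilbert_dist_le x y m n :
  D x -> D y -> cle x y m -> cle y x n -> d x y <= ln (m * n).
Proof.
move=> Dx Dy mxy nyx; have m1 := mxy.1; have n1 := nyx.1.
have [<-|xy] := eqVneq x y.
  by rewrite /hilbert_dist eqxx ln_ge0 //; nra.
have [m' [n' [a [b [[m'1 Bb xE] [n'1 Ba yE] ->]]]]] := hilbert_distE Dx Dy xy.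
have m'm := cone_le_minimal Dy xy Bb m'1 xE mxy.
have n'n : n' <= n.
  by apply: cone_le_minimal Dx _ Ba n'1 yE nyx; rewrite eq_sym.
by rewrite ler_ln ?posrE ?mulr_gt0 ?ler_pM //; lra.
Qed.

Lemma hilbert_dist_cone x y : D x -> D y ->
  exists m n, [/\ cle x y m, cle y x n & d x y = ln (m * n)].
Proof.
move=> Dx Dy; have [<-|xy] := eqVneq x y.
  exists 1, 1; rewrite mulr1 ln1 /hilbert_dist eqxx; split => //; exact: cone_le_refl.
have [m [n [a [b [[m1 [Db _] xE] [n1 [Da _] yE] dE]]]]] := hilbert_distE Dx Dy xy.
exists m, n; split=> //; split; [exact: ltW|by exists b|exact: ltW|by exists a].
Qed.

(** * Metric axioms, homotheties, balls and midpoints *)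

Lemma hilbert_dist_xx x : d x x = 0.
Proof. by rewrite /hilbert_dist eqxx. Qed.

Lemma hilbert_dist_ge0 x y : D x -> D y -> 0 <= d x y.
Proof.
move=> Dx Dy; have [m [n [[m1 _] [n1 _] ->]]] := hilbert_dist_cone Dx Dy.
by rewrite ln_ge0 //; nra.
Qed.

Lemma hilbert_dist_sym x y : D x -> D y -> d x y = d y x.
Proof.
suff le u v : D u -> D v -> d u v <= d v u.
  by move=> Dx Dy; apply/eqP; rewrite eq_le !le.
move=> Du Dv; have [m [n [mvu nuv ->]]] := hilbert_dist_cone Dv Du.
by rewrite mulrC; exact: hilbert_dist_le.
Qed.

Lemma hilbert_dist_triangle x y z : D x -> D y -> D z -> d x z <= d x y + d y z.
Proof.
move=> Dx Dy Dz.
have [m [n [mxy nyx ->]]] := hilbert_dist_cone Dx Dy.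
have [m' [n' [myz nzy ->]]] := hilbert_dist_cone Dy Dz.
have [m1 n1 m'1 n'1] : [/\ 1 <= m, 1 <= n, 1 <= m' & 1 <= n'].
  by split; [case: mxy|case: nyx|case: myz|case: nzy].
rewrite -lnM ?posrE ?mulr_gt0 //; try lra.
have -> : m * n * (m' * n') = m * m' * (n' * n) by ring.
by apply: hilbert_dist_le => //; [exact: cone_le_trans mxy myz|exact: cone_le_trans nzy nyx].
Qed.

(** The homothety sends the boundary point [b] into [D], so [cone_le_strict] lowers the factor on
    that side, while the other factor [n] is kept. *)
Lemma hilbert_dist_homothety_lt x y z s : D x -> D y -> D z -> x != y -> 0 < s < 1 ->
  d (s *: z + (1 - s) *: x) (s *: z + (1 - s) *: y) < d x y.
Proof.
move=> Dx Dy Dz xy /andP[s0 s1]; have s01 : 0 < s <= 1 by rewrite s0 ltW.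
have Dh u : closure D u -> D (s *: z + (1 - s) *: u) by move=> Du; exact: interior_segment.
have [m [n [a [b [[m1 [Db _] xE] [n1 [Da _] yE] ->]]]]] := hilbert_distE Dx Dy xy.
have [|m' m'm hm'] := @cone_le_strict (s *: z + (1 - s) *: x) (s *: z + (1 - s) *: y) _ _ m1 (Dh _ Db).
  by rewrite xE; module_eq R; ring.
have hn : cle (s *: z + (1 - s) *: y) (s *: z + (1 - s) *: x) n.
  split; first exact: ltW.
  exists (s *: z + (1 - s) *: a); first exact/subset_closure/Dh.
  by rewrite yE; module_eq R; ring.
have m'1 := hm'.1.
have := hilbert_dist_le (Dh _ (subset_closure Dx)) (Dh _ (subset_closure Dy)) hm' hn.
by move=> /le_lt_trans; apply; rewrite ltr_ln ?posrE; nra.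
Qed.

Lemma hilbert_dist_homothety_le x y z s : D x -> D y -> D z -> 0 < s < 1 ->
  d (s *: z + (1 - s) *: x) (s *: z + (1 - s) *: y) <= d x y.
Proof.
move=> Dx Dy Dz s01; have [->|xy] := eqVneq x y; first by rewrite !hilbert_dist_xx.
exact/ltW/hilbert_dist_homothety_lt.
Qed.

(** With [m n <= expR M] and [m' n' <= expR M], the factors of the combination reduce the claim to
    [s n + (1 - s) n' <= (s / m + (1 - s) / m') expR M], which holds term by term. *)
Lemma hilbert_ball_convex w x y s M : D w -> D x -> D y -> 0 < s < 1 ->
  d w x <= M -> d w y <= M -> d w (s *: x + (1 - s) *: y) <= M.
Proof.
move=> Dw Dx Dy /andP[s0 s1].
have s01 : 0 < s <= 1 by rewrite s0 ltW.
have s01' : 0 <= s <= 1 by rewrite !ltW.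
have [m [n [mwx nxw ->]]] := hilbert_dist_cone Dw Dx.
have [m' [n' [mwy nyw ->]]] := hilbert_dist_cone Dw Dy.
have [m1 n1 m'1 n'1] : [/\ 1 <= m, 1 <= n, 1 <= m' & 1 <= n'].
  by split; [case: mwx|case: nxw|case: mwy|case: nyw].
have mn0 : 0 < m * n by nra.
have mn0' : 0 < m' * n' by nra.
rewrite -[M in X in X -> _]expRK -[M in X in _ -> X -> _]expRK.
rewrite !ler_ln ?posrE ?expR_gt0 // => mnM mnM'.
have := hilbert_dist_le Dw (interior_segment Dx (subset_closure Dy) s01)
  (cone_le_convexr s01' mwx mwy) (cone_le_convexl s01' nxw nyw).
move=> /le_trans; apply.
have A0 : 0 < s / m + (1 - s) / m' by rewrite addr_gt0 ?divr_gt0 //; lra.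
rewrite -[leRHS]expRK ler_ln ?posrE ?expR_gt0 //; last first.
  by rewrite mulr_gt0 ?invr_gt0 //; nra.
rewrite ler_pdivrMl //.
have -> : (s / m + (1 - s) / m') * expR M = s * (expR M / m) + (1 - s) * (expR M / m').
  by field; rewrite !gt_eqF //; lra.
by apply: lerD; rewrite ler_wpM2l ?subr_ge0 ?(ltW s0) ?(ltW s1) // ler_pdivlMr ?(mulrC n) ?(mulrC n') //; lra.
Qed.

(** The same end [b] serves both halves, and the two factors multiply to exactly [m]; hence the
    additivity of the distance at midpoints. *)
Lemma cone_le_midpoint x y m : cle x y m ->
  cle (2^-1 *: (x + y)) y ((m + 1) / 2) /\
  cle x (2^-1 *: (x + y)) (m / ((m + 1) / 2)).
Proof.
move=> [m1 [b Db xE]]; split; (split; last by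
  exists b => //; rewrite xE; module_eq R; field; lra).
- lra.
- by rewrite ler_pdivlMr; lra.
Qed.

Lemma hilbert_dist_midpoint x y : D x -> D y ->
  d x (2^-1 *: (x + y)) + d (2^-1 *: (x + y)) y <= d x y.
Proof.
move=> Dx Dy; set p := 2^-1 *: (x + y).
have Dp : D p.
  have -> : p = 2^-1 *: x + (1 - 2^-1) *: y by rewrite /p; module_eq R; field.
  by apply: interior_segment => //; [exact: subset_closure|lra].
have [m [n [mxy nyx ->]]] := hilbert_dist_cone Dx Dy.
have [m1 n1] : 1 <= m /\ 1 <= n by case: mxy; case: nyx.
have [mpy mxp] := cone_le_midpoint mxy.
have [] := cone_le_midpoint nyx; rewrite addrC -/p => npx nyp.
apply: le_trans (lerD (hilbert_dist_le Dx Dp mxp npx) (hilbert_dist_le Dp Dy mpy nyp)) _.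
have [m2 n2] : 0 < (m + 1) / 2 /\ 0 < (n + 1) / 2 by lra.
rewrite -lnM ?posrE ?mulr_gt0 ?invr_gt0 //; try lra.
by rewrite le_eqVlt; apply/orP; left; apply/eqP; congr ln; field; lra.
Qed.

(** * Comparison with the norm, and behaviour near the boundary *)

Lemma hilbert_dist_small x e : D x -> 0 < e ->
  exists2 r, 0 < r & forall y, `|x - y| < r -> D y /\ d x y < e.
Proof.
move=> Dx e0; have [r r0 rD] := open_normP oD Dx.
(* With [m] as factor on both sides the distance is at most [e / 2]. The ends this requires differ
   from [x] by [x - y] scaled by at most [m / (m - 1)] in norm, so they stay in the ball inside
   [D]. *)
pose m := expR (e / 4).
have m1 : 1 < m by rewrite expR_gt1 divr_gt0.
have m0 : 0 < m by rewrite expR_gt0.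
have m10 : 0 < m - 1 by lra.
exists (Num.min r (r * (m - 1) / m)); first by rewrite lt_min r0 !divr_gt0 ?mulr_gt0.
move=> y; rewrite lt_min => /andP[xy xy']; have Dy := rD _ xy; split=> //.
have lt u : `|u| < r * (m - 1) / m -> `|(m / (m - 1)) *: u| < r.
  by rewrite normrZ gtr0_norm ?divr_gt0 // ltr_pdivlMr // mulrC => ?; rewrite mulrAC ltr_pdivrMr.
have le1 : cle x y m.
  split; first exact: ltW.
  exists ((m - 1)^-1 *: (m *: y - x)); last by module_eq R; field; rewrite gt_eqF.
  apply/subset_closure/rD.
  have -> : x - (m - 1)^-1 *: (m *: y - x) = (m / (m - 1)) *: (x - y).
    by module_eq R; field; rewrite gt_eqF.
  exact: lt.
have le2 : cle y x m.
  split; first exact: ltW.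
  exists ((m - 1)^-1 *: (m *: x - y)); last by module_eq R; field; rewrite gt_eqF.
  apply/subset_closure/rD.
  have -> : x - (m - 1)^-1 *: (m *: x - y) = - (m - 1)^-1 *: (x - y).
    by module_eq R; field; rewrite gt_eqF.
  rewrite normrZ normrN gtr0_norm ?invr_gt0 // mulrC ltr_pdivrMr //.
  apply: lt_le_trans xy' _; rewrite ler_pdivrMr // ler_peMr ?ltW //.
  by rewrite mulr_gt0.
apply: le_lt_trans (hilbert_dist_le Dx Dy le1 le2) _.
by rewrite -expRD expRK; lra.
Qed.

(** From [x - y = (m - 1) (y - b)] with [m <= expR (d x y)]; as [D] is bounded, the estimate is
    uniform. *)
Lemma norm_small e : 0 < e ->
  exists2 r, 0 < r & forall x y, D x -> D y -> d x y < r -> `|x - y| < e.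
Proof.
move=> e0; have [B B0 DB] := bounded_normP bD.
have c0 : 0 < e / (2 * (B + 1)) by rewrite divr_gt0 //; lra.
exists (ln (1 + e / (2 * (B + 1)))); first by rewrite ln_gt0 // ltrDl.
move=> x y Dx Dy; have [m [n [[m1 [b Db ->]] [n1 _] ->]]] := hilbert_dist_cone Dx Dy.
have -> : m *: y - (m - 1) *: b - y = (m - 1) *: (y - b) by module_eq R; ring.
rewrite ltr_ln ?posrE ?mulr_gt0 //; try lra.
move=> mn; have {mn} me : m - 1 < e / (2 * (B + 1)) by nra.
have yb : `|y - b| <= 2 * (B + 1).
  have [q Dq bq] := (closure_normP _ _).1 Db 1 ltr01.
  have := DB _ Dy; have := DB _ Dq.
  have := ler_normB y b; have := ler_normD (b - q) q; rewrite subrK; lra.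
rewrite normrZ ger0_norm ?subr_ge0 //.
apply: le_lt_trans (ler_wpM2l _ yb) _; first by rewrite subr_ge0.
by rewrite -ltr_pdivlMr //; lra.
Qed.

(** Since [x = o / m + (1 - 1 / m) b], moving [x] to [y] amounts to moving [o] by [m] times as much,
    and [m <= expR M]: Hilbert balls keep a uniform distance from the boundary. *)
Lemma hilbert_ball_interior o M : D o ->
  exists2 r, 0 < r & forall x y, D x -> d o x <= M -> `|x - y| < r -> D y.
Proof.
move=> Do; have [r r0 rD] := open_normP oD Do.
exists (r / expR M); first by rewrite divr_gt0 // expR_gt0.
move=> x y Dx; have [m [n [[m1 [b Db oE]] [n1 _] ->]]] := hilbert_dist_cone Do Dx.
have mn0 : 0 < m * n by nra.
rewrite -{1}(expRK M) ler_ln ?posrE ?expR_gt0 // => mnM xy.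
have m0 : 0 < m by lra.
have -> : y = m^-1 *: (o - m *: (x - y)) + (1 - m^-1) *: b.
  by rewrite oE; module_eq R; field; rewrite gt_eqF.
apply: interior_segment => //; last by rewrite invr_gt0 m0 invf_le1.
apply: rD; rewrite opprB addrC subrK normrZ gtr0_norm // mulrC -ltr_pdivlMr //.
apply: lt_le_trans xy _; rewrite ler_pM2l // lef_pV2 ?posrE ?expR_gt0 //; nra.
Qed.

(** The means by which cluster points obtained from compactness are placed in [D]. *)
Lemma hilbert_bounded_limit o M p : D o ->
  (forall e, 0 < e -> exists2 x, D x /\ d o x <= M & `|x - p| < e) -> D p.
Proof.
move=> Do op; have [r r0 rD] := hilbert_ball_interior M Do.
by have [x [Dx ox] xp] := op _ r0; exact: rD ox xp.
Qed.

(* The midpoint of [p] and [q] is interior, so all nearby segments cross a fixed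
   bounded region: Gromov products of sequences tending to [p] and [q] are bounded. *)
Lemma gromov_product_bounded o p q : D o -> closure D p -> closure D q -> p != q ->
  exists M, exists2 r, 0 < r & forall x y, D x -> D y -> `|x - p| < r -> `|y - q| < r ->
    d x o + d y o <= d x y + M.
Proof.
move=> Do Dp Dq pq; pose c := 2^-1 *: (p + q).
have Dc : D c.
  apply: (sD Dp Dq pq); exists (2^-1) => /=; first by lra.
  by rewrite /c; module_eq R; field.
have [r r0 rP] := hilbert_dist_small Dc ltr01.
exists (2 * (d c o + 1)), r => // x y Dx Dy xp yq.
have [Dm cm] : D (2^-1 *: (x + y)) /\ d c (2^-1 *: (x + y)) < 1.
  apply: rP; have -> : c - 2^-1 *: (x + y) = 2^-1 *: ((p - x) + (q - y)).
    by rewrite /c; module_eq R; ring.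
  rewrite normrZ gtr0_norm ?invr_gt0 //.
  have := ler_normD (p - x) (q - y); rewrite (distrC p) (distrC q); lra.
set m := 2^-1 *: (x + y) in Dm cm *.
have mo := hilbert_dist_triangle Dm Dc Do.
have xo := hilbert_dist_triangle Dx Dm Do.
have yo := hilbert_dist_triangle Dy Dm Do.
have := hilbert_dist_midpoint Dx Dy; rewrite -/m (@hilbert_dist_sym m y) //.
rewrite (@hilbert_dist_sym m c) // in mo; lra.
Qed.

End StrictlyConvexDomain.

(** * Iteration of compact nonexpansive maps *)

Section Iteration.
Set Implicit Arguments.
Unset Strict Implicit.
Context {R : realType} {V : normedModType R} (D : set V).
Context (oD : open D) (bD : bounded_set D) (sD : strictly_convex D).
Context (f : V -> V) (fD : forall x, D x -> D (f x)).
Context (fN : hilbert_nonexpansive D f) (fK : compact_map D f).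
Implicit Types (x y z o c p : V) (s e M : R).
Local Notation d := (hilbert_dist D).
Local Notation triangle := (hilbert_dist_triangle oD bD sD).
Local Notation dist_sym := (hilbert_dist_sym oD bD sD).

Lemma iter_domain n x : D x -> D (iter n f x).
Proof. by move=> Dx; elim: n => //= n; exact: fD. Qed.

Lemma iter_nonexpansive n x y : D x -> D y -> d (iter n f x) (iter n f y) <= d x y.
Proof.
move=> Dx Dy; elim: n => //= n; apply: le_trans.
by apply: fN; exact: iter_domain.
Qed.

Lemma iter_dist_linear n x : D x -> d (iter n f x) x <= n%:R * d (f x) x.
Proof.
move=> Dx; elim: n => [|n IHn]; first by rewrite mul0r hilbert_dist_xx.
have Dn := iter_domain n Dx.
have := triangle (iter_domain n.+1 Dx) Dn Dx.
have := iter_nonexpansive n (fD Dx) Dx; rewrite -iterSr /=.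
rewrite -natr1 mulrDl mul1r; lra.
Qed.

Lemma image_cluster (u : nat -> V) : (forall n, D (u n)) ->
  exists p, closure D p /\
    forall e, 0 < e -> forall N, exists2 n, (N <= n)%N & `|f (u n) - p| < e.
Proof.
move=> Du; have [n|p Kp up] := compact_cluster_seq (u := f \o u) fK.
  by apply: subset_closure; exists (u n).
exists p; split=> //; apply: closure_subset Kp.
by move=> _ [x Dx <-]; exact: fD.
Qed.

(** The displacement of [h] attains its infimum at [p]: for a minimising sequence [u], the points
    [h (u n)] cluster at [p] in norm, and their displacement does not exceed that of [u n]. A
    further application of [h] would lower it strictly. *)
Lemma perturbed_fixpoint (C : set V) z s : C `<=` D -> closure C `<=` C ->
  (forall x y t, C x -> C y -> 0 < t < 1 -> C (t *: x + (1 - t) *: y)) ->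
  (forall x, C x -> C (f x)) -> C z -> 0 < s < 1 ->
  exists2 x, C x & s *: z + (1 - s) *: f x = x.
Proof.
move=> CD clC cC fC Cz s01; pose h x := s *: z + (1 - s) *: f x.
have Ch x : C x -> C (h x) by move=> Cx; apply: cC => //; exact: fC.
have hN x y : C x -> C y -> d (h x) (h y) <= d x y.
  move=> Cx Cy; apply: le_trans (fN (CD _ Cx) (CD _ Cy)).
  by apply: hilbert_dist_homothety_le => //; apply: CD => //; exact: fC.
pose E := [set d x (h x) | x in C].
have infE : has_inf E.
  split; first by exists (d z (h z)); exists z.
  exists 0 => _ [x Cx <-].
  by apply: hilbert_dist_ge0 => //; apply: CD => //; exact: Ch.
have infP x : C x -> inf E <= d x (h x).
  by move=> Cx; apply: (ge_inf infE.2); exists x.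
have /choice[u uP] (n : nat) : exists x, C x /\ d x (h x) < inf E + n.+1%:R^-1.
  have [|_ [x Cx <-] xn] := inf_adherent (eps := n.+1%:R^-1) _ infE.
    by rewrite invr_gt0.
  by exists x.
have Cu n : C (u n) by case: (uP n).
have [w [_ uw]] := image_cluster (fun n => CD _ (Cu n)).
have Cw : C w.
  apply/clC/closure_normP => e /uw/(_ 0%N)[n _ nw].
  by exists (f (u n)); rewrite 1?distrC //; exact: fC.
pose p := s *: z + (1 - s) *: w; have Cp : C p by exact: cC.
have p_le : d p (h p) <= inf E.
  apply/ler_addgt0Pr => e e0.
  have [r r0 rP] := hilbert_dist_small oD bD sD (CD _ Cp) (divr_gt0 e0 (ltr0n _ 3)).
  have [N NP] := invS_small (divr_gt0 e0 (ltr0n _ 3)).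
  have [n Nn nw] := uw _ r0 N.
  have [_ ph] : D (h (u n)) /\ d p (h (u n)) < e / 3.
    apply: rP; rewrite /p /h opprD addrACA subrr add0r -scalerBr normrZ (distrC w).
    apply: le_lt_trans nw; rewrite ler_piMl //.
    by rewrite ger0_norm; lra.
  have hh : d (h (u n)) (h (h (u n))) < inf E + e / 3.
    apply: le_lt_trans (hN _ _ (Cu n) (Ch _ (Cu n))) _.
    by apply: lt_le_trans (proj2 (uP n)) _; rewrite lerD2l ltW // NP.
  have Dh := CD _ (Ch _ (Cu n)); have Dhh := CD _ (Ch _ (Ch _ (Cu n))).
  have Dp := CD _ Cp; have Dhp := CD _ (Ch _ Cp).
  have := triangle Dp Dh Dhp; have := triangle Dh Dhh Dhp.
  have := hN _ _ (Ch _ (Cu n)) Cp; rewrite (dist_sym Dh Dp); lra.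
(* Strict contraction by the homothety requires distinct images under [f]; if they agree,
   [h p = h (h p)] and the fixed point is [h p]. *)
have [fE|fE] := eqVneq (f p) (f (h p)).
  by exists (h p); [exact: Ch|rewrite -fE].
exfalso; have := infP _ (Ch _ Cp); rewrite leNgt => /negP; apply.
apply: lt_le_trans p_le; apply: lt_le_trans (fN (CD _ Cp) (CD _ (Ch _ Cp))).
by apply: hilbert_dist_homothety_lt => //; apply: CD => //; apply: fC => //; exact: Ch.
Qed.

(** The perturbed fixed points satisfy [u n - f (u n) = (z - f (u n)) / (n + 2)], which tends to 0
    by boundedness. So a cluster point of [f (u n)] is one of [u n] too, and [f] is continuous
    there. *)
Lemma nonexpansive_fixpoint (C : set V) : C !=set0 -> C `<=` D -> closure C `<=` C ->
  (forall x y t, C x -> C y -> 0 < t < 1 -> C (t *: x + (1 - t) *: y)) ->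
  (forall x, C x -> C (f x)) -> exists2 x, C x & f x = x.
Proof.
move=> [z Cz] CD clC cC fC; have [B B0 DB] := bounded_normP bD.
have /choice[u uP] (n : nat) :
    exists x, C x /\ n.+2%:R^-1 *: z + (1 - n.+2%:R^-1) *: f x = x.
  have [|x Cx xE] := perturbed_fixpoint (s := n.+2%:R^-1) CD clC cC fC Cz.
    by rewrite invr_gt0 ltr0n /= invf_lt1 ?ltr0n // ltr1n.
  by exists x.
have Cu n : C (u n) by case: (uP n).
have [p [_ up]] := image_cluster (fun n => CD _ (Cu n)).
have Cp : C p.
  apply/clC/closure_normP => e /up/(_ 0%N)[n _ np].
  by exists (f (u n)); rewrite 1?distrC //; exact: fC.
exists p => //; apply/eqP; rewrite -subr_eq0 -normr_le0.
apply/ler_addgt0Pr => e e0; rewrite add0r.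
have e2 : 0 < e / 2 by rewrite divr_gt0.
have [r r0 rP] := norm_small oD bD e2.
have [q q0 qP] := hilbert_dist_small oD bD sD (CD _ Cp) r0.
have m0 : 0 < Num.min (e / 2) (q / 2) by rewrite lt_min e2 divr_gt0.
have [N NP] : exists N, forall n, (N <= n)%N -> n.+1%:R^-1 < q / 2 / (2 * B).
  by apply: invS_small; rewrite !divr_gt0 // mulr_gt0.
have [n Nn] := up _ m0 N; rewrite lt_min => /andP[np np'].
have un : `|u n - f (u n)| < q / 2.
  rewrite -{1}(proj2 (uP n)).
  have -> : n.+2%:R^-1 *: z + (1 - n.+2%:R^-1) *: f (u n) - f (u n) =
      n.+2%:R^-1 *: (z - f (u n)) by module_eq R; ring.
  rewrite normrZ gtr0_norm ?invr_gt0 //.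
  have zf : `|z - f (u n)| <= 2 * B.
    have := ler_normB z (f (u n)); have := DB _ (CD _ Cz).
    have := DB _ (CD _ (fC _ (Cu n))); lra.
  apply: le_lt_trans (ler_wpM2l _ zf) _; first by rewrite invr_ge0.
  by rewrite -ltr_pdivlMr ?mulr_gt0 // NP // (leq_trans Nn).
have [_ pu] : D (u n) /\ d p (u n) < r.
  apply: qP; have := ler_distD (f (u n)) p (u n).
  rewrite (distrC p (f _)) (distrC (f _) (u n)); lra.
have := rP _ _ (fD (CD _ Cp)) (fD (CD _ (Cu n))) (le_lt_trans (fN (CD _ Cp) (CD _ (Cu n))) pu).
have := ler_distD (f (u n)) (f p) p; lra.
Qed.

(* The asymptotic ball of the points [y] with [limsup d (f^n o) y <= M] is convex,
   closed and invariant. *)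
Lemma bounded_orbit_fixpoint o c M : D o -> D c ->
  (forall n, d (iter n f o) c <= M) -> exists2 x, D x & f x = x.
Proof.
move=> Do Dc oM; have Dn n := iter_domain n Do.
pose C := [set y | D y /\ forall e, 0 < e ->
  exists N, forall n, (N <= n)%N -> d (iter n f o) y <= M + e].
suff [x [Dx _] fx] : exists2 x, C x & f x = x by exists x.
apply: nonexpansive_fixpoint.
- exists c; split => // e e0; exists 0%N => n _.
  by apply: le_trans (oM n) _; rewrite lerDl ltW.
- by move=> y [].
- move=> p /closure_normP Cp.
  have Dp : D p.
    (* Some iterate is within [M] of [c] and within [M + 1] of [y]. *)
    apply: (hilbert_bounded_limit (M := M + (M + 1)) oD bD sD Dc) => e /Cp[y [Dy yC] py].
    exists y; last by rewrite distrC.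
    split=> //; have [N /(_ _ (leqnn N)) Ny] := yC _ ltr01.
    apply: le_trans (triangle Dc (Dn N) Dy) (lerD _ Ny).
    by rewrite dist_sym.
  split=> // e e0; have e2 : 0 < e / 2 by rewrite divr_gt0.
  have [r r0 rP] := hilbert_dist_small oD bD sD Dp e2.
  have [y [Dy yC] py] := Cp _ r0; have [_ dpy] := rP _ py.
  have [N NP] := yC _ e2; exists N => n /NP ny.
  have := triangle (Dn n) Dy Dp; rewrite (dist_sym Dy Dp); lra.
- move=> x y t [Dx xC] [Dy yC] t01.
  split=> [|e e0].
    apply: interior_segment => //; first exact: subset_closure.
    by case/andP: t01 => -> /ltW.
  have [N NP] := xC _ e0; have [N' NP'] := yC _ e0.
  exists (maxn N N') => n; rewrite geq_max => /andP[Nn N'n].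
  by apply: hilbert_ball_convex => //; [exact: NP|exact: NP'].
- move=> x [Dx xC]; split=> [|e e0]; first exact: fD.
  have [N NP] := xC _ e0; exists N.+1 => -[//|n] Nn.
  by apply: le_trans (NP _ Nn); rewrite iterS; exact: fN.
Qed.

(* Calka's argument: if the orbit accumulates at a point of [D], compactness bounds
   the time between two consecutive visits to a ball, so the orbit is bounded. *)
Lemma orbit_escapes o M : fixed_points D f = set0 -> D o ->
  exists N, forall n, (N <= n)%N -> M < d (iter n f o) o.
Proof.
move=> fix0 Do; apply: contrapT => noN; have Dn n := iter_domain n Do.
have /choice[k kP] (N : nat) : exists n, (N <= n)%N /\ d (iter n.+1 f o) o <= M.
  apply: contrapT => H; apply: noN; exists N.+1 => -[//|n] Nn.
  by rewrite ltNge; apply/negP => ?; apply: H; exists n.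
have [w [_ kw]] := image_cluster (fun N => Dn (k N)).
have Dw : D w.
  apply: (hilbert_bounded_limit (M := M) oD bD sD Do) => e /kw/(_ 0%N)[n _ nw].
  exists (iter (k n).+1 f o) => //; split=> //.
  by rewrite dist_sym //; case: (kP n).
have visit e N : 0 < e -> exists2 n, (N <= n)%N & d (iter n f o) w < e.
  move=> e0; have [r r0 rP] := hilbert_dist_small oD bD sD Dw e0.
  have [n Nn nw] := kw _ r0 N; exists (k n).+1.
    by rewrite (leq_trans Nn) // leqW //; case: (kP n).
  by rewrite dist_sym //; apply: (proj2 (rP _ _)); rewrite distrC.
have [P gap] : exists P, forall n, d (iter n f o) w <= 1 ->
    exists j, [/\ (0 < j)%N, (j <= P)%N & d (iter (n + j) f o) w <= 1].
  apply: contrapT => noP.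
  have /choice[l lP] (P : nat) : exists n, d (iter n f o) w <= 1 /\
      forall j, (0 < j)%N -> (j <= P)%N -> 1 < d (iter (n + j) f o) w.
    apply: contrapT => H; apply: noP; exists P => n nw.
    apply: contrapT => H'; apply: H; exists n; split=> // j j0 jP.
    by rewrite ltNge; apply/negP => ?; apply: H'; exists j.
  have [q [_ lq]] := image_cluster (fun N => Dn (l N)).
  have Dq : D q.
    (* The centre is [f w]: one application of [f] keeps the visits [l n] within distance 1. *)
    apply: (hilbert_bounded_limit (M := 1) oD bD sD (fD Dw)) => e /lq/(_ 0%N)[n _ nq].
    exists (f (iter (l n) f o)) => //; split; first exact: fD.
    by rewrite dist_sym; try exact: fD; apply: le_trans (fN _ _) (proj1 (lP n)).
  have q4 : 0 < 4^-1 :> R by rewrite invr_gt0.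
  have [r r0 rP] := hilbert_dist_small oD bD sD Dq q4.
  have near N : exists2 n, (N <= n)%N & d q (iter (l n).+1 f o) < 4^-1.
    have [n Nn nq] := lq _ r0 N; exists n => //.
    by apply: (proj2 (rP _ _)); rewrite distrC.
  (* The orbits started just after the times [l a] and [l b] are both near [q], hence stay within
     1/2 of each other. The first returns to within 1/2 of [w] at time [m], so the second is within
     1 of [w] after [m - l a <= b] steps, against the choice of [l b]. *)
  have [a _ aq] := near 0%N.
  have h2 : 0 < 2^-1 :> R by rewrite invr_gt0.
  have [m am mw] := visit _ (l a).+1 h2.
  have [b bP bq] := near (m - l a)%N.
  have ml : (0 < m - l a)%N by rewrite subn_gt0.
  have := proj2 (lP b) _ ml bP; apply/negP; rewrite -leNgt.
  have -> : (l b + (m - l a) = (m - (l a).+1) + (l b).+1)%N.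
    by rewrite addnS -addSn subnSK // addnC.
  have mE : (m = (m - (l a).+1) + (l a).+1)%N by rewrite subnK.
  have step := iter_nonexpansive (m - (l a).+1) (Dn (l b).+1) (Dn (l a).+1).
  rewrite -!iterD -mE in step.
  have := triangle (Dn (m - (l a).+1 + (l b).+1)%N) (Dn m) Dw.
  have := triangle (Dn (l b).+1) Dq (Dn (l a).+1).
  rewrite (dist_sym (Dn (l b).+1) Dq); lra.
have [n0 _ n0w] := visit 1 0%N ltr01.
have last_visit j : exists m, [/\ (m <= n0 + j)%N, (n0 + j <= m + P)%N & d (iter m f o) w <= 1].
  elim: j => [|j [m [mj jm mw]]].
    by exists n0; rewrite addn0 leqnn leq_addr ltW.
  have [jm'|jm'] := leqP (n0 + j.+1) (m + P).
    by exists m; split=> //; rewrite addnS leqW.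
  have [i [i0 iP iw]] := gap _ mw.
  by exists (m + i)%N; split=> //; lia.
have [x Dx fx] : exists2 x, D x & f x = x.
  apply: (bounded_orbit_fixpoint (M := P%:R * d (f o) o + 1) (Dn n0) Dw) => j.
  have [m [mj jm mw]] := last_visit j; rewrite -iterD addnC.
  (* At most [P] steps separate [n0 + j] from the visit [m]; as [f^m] is nonexpansive, they move the
     orbit no further than the same number of steps from [o]. *)
  have -> : (n0 + j = m + (n0 + j - m))%N by rewrite subnKC.
  apply: le_trans (triangle (Dn _) (Dn m) Dw) (lerD _ mw).
  rewrite iterD; apply: le_trans (iter_nonexpansive _ (Dn _) Do) _.
  apply: le_trans (iter_dist_linear _ Do) _.
  apply: ler_wpM2r; first by rewrite hilbert_dist_ge0 //; exact: fD.
  by rewrite ler_nat leq_subLR.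
by have : fixed_points D f x by []; rewrite fix0.
Qed.

(* Karlsson's argument: at the record times [k] of [d (f^k o) o], the Gromov products
   of [f^k o] with [f^n x], [n <= k], are at least of the order of [d (f^n x) o]. *)
Lemma iterates_converge o : fixed_points D f = set0 -> D o ->
  exists2 xi, bdry D xi & forall M e, 0 < e ->
    exists N, forall n, (N <= n)%N -> forall x, D x -> d x o <= M ->
      `|iter n f x - xi| < e.
Proof.
move=> fix0 Do; pose g n := d (iter n f o) o.
have goo M : exists N, forall n, (N <= n)%N -> M < g n by exact: orbit_escapes.
have /choice[k kP] (N : nat) : exists n, (N <= n)%N /\
    forall m, (m <= n.+1)%N -> g m <= g n.+1.
  by have [[//|n] Nn nP] := record_time goo N.+1; exists n.
have [xi [Dxi kxi]] := image_cluster (fun N => iter_domain (k N) Do).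
exists xi.
  split=> // Dxi'; have [r r0 rP] := hilbert_dist_small oD bD sD Dxi' ltr01.
  have [N NP] := goo (1 + d xi o); have [n Nn nxi] := kxi _ r0 N.
  have [|Dk xik] := rP (iter (k n).+1 f o); first by rewrite distrC.
  have := NP (k n).+1; rewrite (leq_trans Nn) ?leqW ?(proj1 (kP n)) // => /(_ isT).
  have := triangle Dk Dxi' Do; rewrite (dist_sym Dk Dxi') -/(g _); lra.
move=> M e e0; apply: contrapT => noN.
have /choice[u uP] (N : nat) : exists nx : nat * V, [/\ (N <= nx.1)%N, D nx.2,
    d nx.2 o <= M & e <= `|iter nx.1.+1 f nx.2 - xi|].
  apply: contrapT => H; apply: noN; exists N.+1 => -[//|n] Nn x Dx xM.
  by rewrite ltNge; apply/negP => ?; apply: H; exists (n, x).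
have Du n : D (iter (u n).1 f (u n).2) by apply: iter_domain; case: (uP n).
have [eta [Deta ueta]] := image_cluster Du.
have xi_eta : xi != eta.
  apply/eqP => E; have [n _] := ueta _ e0 0%N; rewrite -E ltNge.
  by case: (uP n) => _ _ _ ->.
have [M' [r r0 rP]] := gromov_product_bounded oD bD sD Do Dxi Deta xi_eta.
(* Let [K = k i + 1], [L = n + 1] and [t = K - L]. The Gromov bound gives [g K + d (f^L x) o <= d
   (f^K o) (f^L x) + M'], where the right side is at most [g t + M + M' <= g K + M + M'] and
   [d (f^L x) o >= g L - M]. Hence [g L <= M' + 2 M], which this [N] forbids. *)
have [N NP] := goo (M' + 2 * M).
have [j Nj jeta] := ueta _ r0 N.
have [] := uP j; case: (u j) jeta => n x /= jeta jn Dx xM _.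
have [i ni ixi] := kxi _ r0 n.+1.
have Dn m y := @iter_domain m y; pose t := ((k i).+1 - n.+1)%N.
have tE : (n.+1 + t = (k i).+1)%N.
  by rewrite subnKC // (leq_trans ni) // leqW //; case: (kP i).
have gt : g t <= g (k i).+1 by apply: (proj2 (kP i)); rewrite leq_subr.
have := rP _ _ (Dn (k i).+1 _ Do) (Dn n.+1 _ Dx) ixi jeta.
have := NP n.+1; rewrite leqW ?(leq_trans Nj) // => /(_ isT).
have := iter_nonexpansive n.+1 (Dn t _ Do) Dx; rewrite -iterD tE.
have := iter_nonexpansive n.+1 Do Dx.
have := triangle (Dn t _ Do) Do Dx; rewrite (dist_sym Do Dx).
have := triangle (Dn n.+1 _ Do) (Dn n.+1 _ Dx) Do.
rewrite /g in gt *; lra.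
Qed.

End Iteration.

(** * Passage to continuous time *)

Section Semigroup.
Set Implicit Arguments.
Unset Strict Implicit.
Context {R : realType} {V : normedModType R} (D : set V) (F : R -> V -> V).
Context (oD : open D) (bD : bounded_set D) (sD : strictly_convex D).
Context (semiF : continuous_semigroup D F).
Context (nF : forall t, 0 <= t -> hilbert_nonexpansive D (F t)).
Local Notation d := (hilbert_dist D).
Local Notation triangle := (hilbert_dist_triangle oD bD sD).

Lemma semigroup_domain t x : 0 <= t -> D x -> D (F t x).
Proof. by case: semiF => FD _ _ _ t0 Dx; apply: (FD t t0); exists x. Qed.

Lemma semigroup_iter n t x : 0 <= t -> D x -> iter n (F t) x = F (n%:R * t) x.
Proof.
case: semiF => _ FA F0 _ t0 Dx; elim: n => [|n IHn]; first by rewrite mul0r F0.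
by rewrite iterS IHn -FA ?mulr_ge0 // -natr1 mulrDl mul1r.
Qed.

(** Continuity at time 0 bounds the displacement of [o] by 1 on some [[0, h]]; nonexpansiveness adds
    at most 1 for each further step [h]. *)
Lemma semigroup_bounded_orbit t o : D o ->
  exists A, forall s, 0 <= s <= t -> d (F s o) o <= A.
Proof.
move=> Do; have [_ FA F0 Fc] := semiF.
have [r r0 rP] := hilbert_dist_small oD bD sD Do ltr01.
have /cvgrPdist_lt/(_ _ r0)/nbhs_ballP[e /= e0 eP] := Fc _ Do.
pose h := e / 2; have h0 : 0 < h by rewrite divr_gt0.
have small s : 0 <= s <= h -> d (F s o) o <= 1.
  rewrite le_eqVlt => /andP[/predU1P[<- _|s0 sh]]; first by rewrite F0 // hilbert_dist_xx.
  rewrite (hilbert_dist_sym oD bD sD (semigroup_domain (ltW s0) Do) Do).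
  apply/ltW/(proj2 (rP _ _))/eP => //.
  rewrite -ball_normE /= sub0r normrN gtr0_norm //.
  by apply: le_lt_trans sh _; rewrite /h; lra.
have bound k s : 0 <= s <= k%:R * h -> d (F s o) o <= k%:R.
  elim: k s => [|k IHk] s.
    rewrite mul0r => /le_anti <-; by rewrite F0 // hilbert_dist_xx.
  move=> /andP[s0]; rewrite -natr1 mulrDl mul1r => sk.
  have [sh|hs] := leP s h.
    by apply: le_trans (small s _) _; rewrite ?s0 // lerDr.
  have sh0 : 0 <= s - h by lra.
  have -> : F s o = F (s - h) (F h o) by rewrite -FA ?(ltW h0) // subrKC.
  have Dh := semigroup_domain (ltW h0) Do.
  have := triangle (semigroup_domain sh0 Dh) (semigroup_domain sh0 Do) Do.
  have := nF sh0 Dh Do; have := small h; rewrite lexx ltW // => /(_ isT).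
  have : d (F (s - h) o) o <= k%:R by apply: IHk; lra.
  lra.
exists (Num.truncn (t / h)).+1%:R => s /andP[s0 st]; apply: bound.
rewrite s0 /=; have : t / h < (Num.truncn (t / h)).+1%:R by exact: truncnS_gt.
by rewrite ltr_pdivrMr //; lra.
Qed.

End Semigroup.

Theorem corollary3p10 (R : realType) (V : completeNormedModType R)
    (D : set V) (F : R -> V -> V) (t0 : R) :
  domain D -> bounded_set D -> strictly_convex D ->
  continuous_semigroup D F ->
  (forall t, 0 <= t -> hilbert_nonexpansive D (F t)) ->
  0 < t0 -> fixed_points D (F t0) = set0 -> compact_map D (F t0) ->
  exists2 xi : V, bdry D xi &
    forall C : set V, C `<=` D -> hilbert_bounded D C ->
      sup [set `|F t x - xi| | x in C] @[t --> +oo] --> (0 : R).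
Proof.
move=> [] [p Dp] oD _ bD sD semiF nF t0_gt0 fix0 cF.
have t0_ge0 := ltW t0_gt0.
have FD t x := @semigroup_domain _ _ D F semiF t x.
have [xi Bxi xiP] := iterates_converge oD bD sD (fun x => FD t0 x t0_ge0) (nF t0 t0_ge0) cF fix0 Dp.
exists xi => // C CD [M CM].
have [A AP] := semigroup_bounded_orbit oD bD sD semiF nF t0 Dp.
(* The supremum of the empty set is 0 by convention; otherwise [c] anchors the bound on distances to
   [p]. *)
have [->|/set0P[c Cc]] := eqVneq C set0.
  by under eq_fun do rewrite image_set0 sup0; exact: cvg_cst.
have Co x : C x -> hilbert_dist D x p <= M + hilbert_dist D c p.
  move=> Cx; apply: le_trans (hilbert_dist_triangle oD bD sD (CD _ Cx) (CD _ Cc) Dp) _.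
  by rewrite lerD2r CM.
(* The radius covers [F s x] for all [x] in [C] and [0 <= s <= t0]: [A] bounds the displacement of
   [p], the rest bounds [d x p]. *)
apply/cvgrPdist_le => e e0; have [N NP] := xiP (A + (M + hilbert_dist D c p)) e e0.
exists (N%:R * t0); split; first exact: num_real.
move=> t; rewrite -ltr_pdivlMr // => Nt; rewrite sub0r normrN.
have t_ge0 : 0 <= t / t0 by rewrite (le_trans _ (ltW Nt)).
have := truncn_itv t_ge0; have := ltW Nt; rewrite -(truncn_ge_nat N t_ge0).
move: (Num.truncn _) => n Nn /andP[nt tn].
rewrite ler_pdivlMr // in nt; rewrite ltr_pdivrMr // in tn.
pose s := t - n%:R * t0.
have s_ge0 : 0 <= s by rewrite subr_ge0.
have st0 : s <= t0 by move: tn; rewrite -natr1 mulrDl mul1r /s; lra.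
have near_xi x : C x -> `|F t x - xi| <= e.
  move=> Cx; have Dx := CD _ Cx; have Ds := FD s _ s_ge0 Dx; have Dso := FD s _ s_ge0 Dp.
  (* The remainder [s] acts first, so that the iterates start from a fixed bounded set, on which
     convergence is uniform. *)
  have -> : F t x = iter n (F t0) (F s x).
    rewrite (semigroup_iter semiF) //; have [_ FA _ _] := semiF.
    by rewrite -FA ?mulr_ge0 // subrK.
  apply/ltW/NP => //.
  apply: le_trans (hilbert_dist_triangle oD bD sD Ds Dso Dp) _.
  rewrite addrC lerD ?AP ?s_ge0 //.
  by apply: le_trans (nF s s_ge0 x p Dx Dp) (Co x Cx).
have ub : ubound [set `|F t x - xi| | x in C] e by move=> _ [x /near_xi ? <-].
rewrite ger0_norm; first by apply: ge_sup => //; exists `|F t c - xi|; exists c.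
apply: le_trans (normr_ge0 (F t c - xi)) _.
by apply: ub_le_sup; [exists e|exists c].
Qed.
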